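(* Let $\Pi=\Gamma_d\circ\Gamma_s$ on $\Sigma^*$. For every $U\in\Sigma^{*}$: (1) $\Pi(U1)=\overline{\Pi(U)}\,2$; (2) $\Pi(U2)=\Pi(\Pi(U))\,1$; (3) $\Gamma_{s}(UX)=\Pi\big(\Gamma_{s}(U)\,\overline{X}\big)$ for every $X\in\Sigma$; (4) $\Gamma_{d}(U)=\Pi(\Gamma_{s}(U))$.
   Context: Let $\Sigma=\{1,2\}$, $\Sigma_0=\{0,1,2\}$. The complement $\overline{w}$ of a word over $\Sigma$ exchanges $1$ and $2$ (so for a letter $X\in\Sigma$, $\overline{X}$ is the other letter); $w[i]$ is the $(i+1)$-th letter, $\tilde w$ the reversal; juxtaposition denotes concatenation. For $w=x_1^{i_1}\cdots x_n^{i_n}$ over $\Sigma$ (maximal runs), $\Delta(w)=i_1\cdots i_n$. The derivative: $D(\epsilon)=\epsilon$, otherwise (when $\Delta(w)$ is over $\Sigma$) $D(w)$ is $\Delta(w)$ with its first symbol deleted if it is $1$ and its last symbol deleted if it is $1$. $\mathbf{C}^{\infty}$ is the set of words with $D^j(w)$ defined for all $j$. Height: least $k$ with $D^k(w)=\epsilon$; root: $D^{k-1}(w)$; single-/double-rooted if the root has length one/two. A primitive of $w$ is $w'$ with $D(w')=w$. $w\in\mathbf{C}^{\infty}$ of height $k>1$ is minimal if for each $0\le j\le k-2$, $D^j(w)$ is a primitive of $D^{j+1}(w)$ of minimal length among all its primitives; words of height $1$ are minimal. Left frontier of $w$ of height $k>0$: the word $\Psi(w)$ of length $k$ with $\Psi(w)[0]=w[0]$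 and for $0<i<k$, $\Psi(w)[i]=0$ if $D^i(w)[0]=2$ and $D^{i-1}(w)[0]\ne D^{i-1}(w)[1]$, else $\Psi(w)[i]=D^i(w)[0]$; $\Psi(\epsilon)=\epsilon$. Right frontier: $\Psi(\tilde w)$. Each $U\in\Sigma^*$ is the left frontier of a unique single-rooted minimal word and of a unique double-rooted minimal word; $\Gamma_s(U)$ (resp. $\Gamma_d(U)$) is the right frontier of the single-rooted (resp. double-rooted) minimal word with left frontier $U$, with $\Gamma_s(\epsilon)=\Gamma_d(\epsilon)=\epsilon$. Both are maps $\Sigma^*\to\Sigma^*$. *)

(* Defs.v *)
From HB Require Import structures.
From mathcomp Require Import all_boot.
From Stdlib Require ClassicalEpsilon.

Set Implicit Arguments.
Unset Strict Implicit.
Unset Printing Implicit Defensive.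

(* Sigma; words over Sigma are [seq letter]. Words over Sigma_0 = {0, 1, 2}
   are coded as [seq nat] through the coercion [nat_of_letter]. *)
Inductive letter := One | Two.

Definition bool_of_letter (x : letter) : bool := if x is One then false else true.
Definition letter_of_bool (b : bool) : letter := if b then Two else One.

Lemma bool_of_letterK : cancel bool_of_letter letter_of_bool.
Proof. by case. Qed.

HB.instance Definition _ := Countable.copy letter (can_type bool_of_letterK).

Coercion nat_of_letter (x : letter) : nat := if x is One then 1 else 2.

Definition letter_of_nat (n : nat) : option letter :=
  match n with 1 => Some One | 2 => Some Two | _ => None end.

Definition flip (x : letter) : letter := if x is One then Two else One.

Definition complement (w : seq letter) : seq letter := map flip w.

(* [runs_from x n w]: run lengths of [nseq n x ++ w], for 0 < n *)
Fixpoint runs_from (x : letter) (n : nat) (w : seq letter) : seq nat :=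
  match w with
  | [::] => [:: n]
  | y :: w' => if y == x then runs_from x n.+1 w' else n :: runs_from y 1 w'
  end.

Definition Delta (w : seq letter) : seq nat :=
  if w is x :: w' then runs_from x 1 w' else [::].

Fixpoint word_of_nats (s : seq nat) : option (seq letter) :=
  match s with
  | [::] => Some [::]
  | n :: s' =>
      if letter_of_nat n is Some x then omap (cons x) (word_of_nats s') else None
  end.

Definition trim_head (w : seq letter) : seq letter :=
  if w is One :: w' then w' else w.

Definition trim (w : seq letter) : seq letter :=
  rev (trim_head (rev (trim_head w))).

(* [None] means undefined, i.e., [Delta w] is not a word over Sigma *)
Definition D (w : seq letter) : option (seq letter) :=
  omap trim (word_of_nats (Delta w)).

Definition Diter (j : nat) (w : seq letter) : option (seq letter) :=
  iter j (obind D) (Some w).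

Definition Cinf (w : seq letter) : Prop := forall j, Diter j w <> None.

(* The value D^j(w); the default is never used on words of [Cinf]. *)
Definition Dw (j : nat) (w : seq letter) : seq letter :=
  odflt [::] (Diter j w).

(* The least k such that D^k(w) is empty; on [Cinf] the search bound [size w]
   is always sufficient, see [heightP]. *)
Definition height (w : seq letter) : nat :=
  find (fun k => Diter k w == Some [::]) (iota 0 (size w).+1).

Definition Droot (w : seq letter) : seq letter := Dw (height w).-1 w.

Definition single_rooted (w : seq letter) : Prop := size (Droot w) = 1.
Definition double_rooted (w : seq letter) : Prop := size (Droot w) = 2.

Definition primitive (w' w : seq letter) : Prop := D w' = Some w.

Definition shortest_primitive (w' w : seq letter) : Prop :=
  primitive w' w /\ forall w'', primitive w'' w -> size w' <= size w''.

(* For words of height 1 the last condition is void. *)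
Definition minimal (w : seq letter) : Prop :=
  [/\ Cinf w, 0 < height w &
      forall j, j.+2 <= height w -> shortest_primitive (Dw j w) (Dw j.+1 w)].

Definition Psi_letter (w : seq letter) (i : nat) : nat :=
  let c j := nth One (Dw j w) in
  if (0 < i) && (c i 0 == Two) && (c i.-1 0 != c i.-1 1) then 0 else c i 0.

Definition Psi (w : seq letter) : seq nat := mkseq (Psi_letter w) (height w).

Definition left_frontier (w : seq letter) : seq nat := Psi w.
Definition right_frontier (w : seq letter) : seq nat := Psi (rev w).

(* [V] is the right frontier of a minimal word with left frontier [U] whose
   root satisfies the condition [rooted]. *)
Definition frontier_image (rooted : seq letter -> Prop) (U V : seq letter) : Prop :=
  exists w, [/\ minimal w, rooted w,
                left_frontier w = map nat_of_letter U &
                right_frontier w = map nat_of_letter V].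

(* For nonempty [U] there is exactly one such [V] for either kind of root, so
   the description operator selects it. *)
Definition Gamma (rooted : seq letter -> Prop) (U : seq letter) : seq letter :=
  if U is [::] then [::]
  else ClassicalEpsilon.epsilon (inhabits [::]) (frontier_image rooted U).

Definition Gamma_s : seq letter -> seq letter := Gamma single_rooted.
Definition Gamma_d : seq letter -> seq letter := Gamma double_rooted.

Definition Pi (U : seq letter) : seq letter := Gamma_d (Gamma_s U).

Lemma size_word_of_nats s v : word_of_nats s = Some v -> size v = size s.
Proof.
elim: s v => [|n s IH] v /=; first by case=> <-.
by case: (letter_of_nat n) => //= x; case: (word_of_nats s) IH => //= u /(_ u erefl) <- [<-].
Qed.

Lemma size_trim_head w : size (trim_head w) <= size w.
Proof. by case: w => [|[] w] //=. Qed.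

Lemma size_trim w : size (trim w) <= size w.
Proof.
rewrite /trim size_rev; apply: leq_trans (size_trim_head _) _.
by rewrite size_rev size_trim_head.
Qed.

Lemma size_runs_from x n w :
  size (runs_from x n w) <= (size w).+1 /\
  (size (runs_from x n w) = (size w).+1 -> exists s, runs_from x n w = n :: s).
Proof.
elim: w x n => [|y w IH] x n /=; first by split=> // _; exists [::].
case: eqP => _ /=.
  by have [le _] := IH x n.+1; split; [exact: leqW | move=> e; rewrite e ltnn in le].
by have [le _] := IH y 1; split=> // _; exists (runs_from y 1 w).
Qed.

Lemma size_D w v : w != [::] -> D w = Some v -> size v < size w.
Proof.
case: w => [|x w] // _; rewrite /D /=.
have [le eqs] := size_runs_from x 1 w.
case E: (word_of_nats _) => [u|] //= [<-].
have su := size_word_of_nats E; move: le; rewrite leq_eqVlt => /orP [/eqP e|lt].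
  have [s es] := eqs e; move: E su; rewrite e es /=.
  case: (word_of_nats s) => //= t [<-] /= [<-].
  rewrite ltnS /trim size_rev; apply: leq_trans (size_trim_head _) _.
  by rewrite size_rev.
by apply: leq_ltn_trans (size_trim u) _; rewrite su.
Qed.

Lemma heightP w : Cinf w ->
  Diter (height w) w = Some [::] /\
  forall k, k < height w -> Diter k w <> Some [::].
Proof.
move=> Cw.
have bnd k : exists2 v, Diter k w = Some v & size v <= size w - k.
  elim: k => [|k [v ev sv]]; first by exists w; rewrite ?subn0.
  case E: (Diter k.+1 w) => [u|]; last by case: (Cw _ E).
  exists u => //; move: E; rewrite /Diter iterS -/(Diter k w) ev /= => Du.
  have [v0|v0] := eqVneq v [::]; first by move: Du; rewrite v0 => -[<-].
  by rewrite subnS -ltnS; have := leq_trans (size_D v0 Du) sv; case: (_ - _).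
have hs : has (fun k => Diter k w == Some [::]) (iota 0 (size w).+1).
  apply/hasP; exists (size w); first by rewrite mem_iota add0n ltnSn.
  by have [v ->] := bnd (size w); rewrite subnn leqn0 size_eq0 => /eqP ->.
have lth : height w < (size w).+1 by move: (hs); rewrite has_find size_iota.
split; first by have /eqP := nth_find 0 hs; rewrite nth_iota.
move=> k ltk; have := before_find 0 ltk; rewrite nth_iota ?add0n; last exact: ltn_trans lth.
by move/eqP.
Qed.

(* Main.v *)
Require Import Defs.
From mathcomp Require Import all_boot.
From Stdlib Require ClassicalEpsilon.

(** A minimal word is obtained from its root by iterating the shortest
    integration [integ x], so it is [build U r] for its left frontier
    [rcons U (head r)] and its root [r]; its right frontier is then read off the
    last letters of the intermediate words and reversing the word exchanges the
    two frontiers.  Integration respects prefixes and suffixes, so when a word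
    [p m q] is integrated repeatedly, the parts over [p m] and [m q] overlap in
    a word built over [m]: the right frontier over [p m q] is found by passing
    from [p m] to [m] to [m q] ([ends_glue]).  Cutting the integrated roots 121,
    1211, 2212 in overlapping pieces gives [Pi (U X) = Gamma_s (Gamma_s U (flip X))]
    and [Gamma_s (U 1) = (Gamma_d (Gamma_s (Gamma_d U))) 1].  Finally the words
    built over 11 and 12 (or 22 and 21) differ exactly in their last letter,
    whence [Gamma_s (V 2) = (complement (Gamma_d V)) 2]. *)

Set Implicit Arguments.
Unset Strict Implicit.
Unset Printing Implicit Defensive.

Lemma flipK : involutive flip. Proof. by case. Qed.

Lemma eq_flip x : (flip x == x) = false. Proof. by case: x. Qed.

Lemma nat_of_letter_inj : injective nat_of_letter.
Proof. by case; case. Qed.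

(** * Shortest integration *)

Fixpoint expand (x : letter) (s : seq letter) : seq letter :=
  match s with
  | [::] => [::]
  | One :: s' => x :: expand (flip x) s'
  | Two :: s' => x :: x :: expand (flip x) s'
  end.

(** [trim] deletes a leading 1, so a leading 1 of [v] survives only behind another 1, while a
    leading 2 needs no companion; the right end is symmetric. The default [Two] in [padr] leaves the
    empty word unpadded. *)
Definition padl (v : seq letter) : seq letter := if v is One :: _ then [:: One] else [::].
Definition padr (v : seq letter) : seq letter :=
  if last Two v is One then [:: One] else [::].

Definition pad (v : seq letter) : seq letter := padl v ++ v ++ padr v.

Definition integ (x : letter) (v : seq letter) : seq letter := expand x (pad v).

Lemma expand_cat x s t :
  expand x (s ++ t) = expand x s ++ expand (iter (size s) flip x) t.
Proof.
elim: s x => [|a s IH] x //=.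
by case: a; rewrite IH -iterSr.
Qed.

Lemma expand_rcons x a s :
  exists P, expand x (rcons s a) = rcons P (iter (size s) flip x).
Proof.
rewrite -cats1 expand_cat; case: a => /=.
  by exists (expand x s); rewrite cats1.
by exists (rcons (expand x s) (iter (size s) flip x)); rewrite -!cats1 -catA.
Qed.

(** The last run is reached after [size s - 1] flips; [(size s).+1] has the same parity and avoids a
    predecessor. *)
Lemma rev_expand x s : rev (expand x s) = expand (iter (size s).+1 flip x) (rev s).
Proof.
elim/last_ind: s => [|s a IH] //.
rewrite -cats1 expand_cat rev_cat IH rev_cat size_cat addn1 /= flipK.
by case: a.
Qed.

Lemma size_expand x s : size (expand x s) = sumn (map nat_of_letter s).
Proof. by elim: s x => [|a s IH] x //=; case: a => /=; rewrite IH. Qed.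

Lemma padl_rev u : padl (rev u) = padr u.
Proof. by case/lastP: u => [|u a] //; rewrite rev_rcons /padr last_rcons. Qed.

Lemma rev_padl u : rev (padl u) = padl u.
Proof. by case: u => [|[]]. Qed.

Lemma rev_padr u : rev (padr u) = padr u.
Proof. by rewrite -padl_rev rev_padl. Qed.

Lemma rev_pad v : rev (pad v) = pad (rev v).
Proof.
by rewrite /pad !rev_cat rev_padl rev_padr padl_rev -[in padr (rev v)]padl_rev revK catA.
Qed.

Lemma rev_integ x v : exists y, rev (integ x v) = integ y (rev v).
Proof. by rewrite /integ rev_expand rev_pad; eexists. Qed.

Lemma integ_cons x v : v != [::] -> exists w, integ x v = x :: w.
Proof. by case: v => [|[] v] // _; eexists. Qed.

Lemma integ_neq0 x v : v != [::] -> integ x v != [::].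
Proof. by move=> /(integ_cons x) [w ->]. Qed.

(** A trailing 1 of [m] is padded by a further run of length 1. In the integral of [m ++ q] its
    letter is the first one of the run coded by the head of [q], whether that head is 1 or 2. *)
Lemma integ_prefix y m q : m != [::] -> exists Q, integ y (m ++ q) = integ y m ++ Q.
Proof.
case: m => // a m _; case: q => [|b q]; first by exists [::]; rewrite !cats0.
set s := padl (a :: m) ++ a :: m; set t := b :: q ++ padr (b :: q).
have -> : integ y ((a :: m) ++ b :: q) = expand y (s ++ t).
  by rewrite /integ /pad /s /t /padr last_cat /= -!catA.
have -> : integ y (a :: m) = expand y (s ++ padr (a :: m)).
  by rewrite /integ /pad /s -catA.
rewrite /t {t} /padr; move: s (q ++ _) (last _ (a :: m)) => s t [];
  rewrite !expand_cat /=; last by eexists; rewrite cats0.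
by case: b; eexists; rewrite -catA.
Qed.

(** For nonempty [p]: if [m] starts with 2, the cut falls between two runs; if it starts with 1, the
    last letter of the preceding run serves as the run of length 1 that pads [m]. [P] and [y] are
    independent of [q], which lets [q] vary in [ends_glue]. *)
Lemma integ_suffix x p m : m != [::] ->
  exists P y, forall q, integ x (p ++ m ++ q) = P ++ integ y (m ++ q).
Proof.
case: p => [|b p]; first by exists [::], x.
case: m => // a m _.
set s := padl (b :: p) ++ b :: p; set z := iter (size s) flip x.
have split q : integ x ((b :: p) ++ (a :: m) ++ q) =
    expand x s ++ expand z (a :: m ++ q ++ padr (a :: m ++ q)).
  rewrite /integ /pad -expand_cat /s [padr (_ ++ _)]/padr last_cat.
  by rewrite -!catA.
case: a split => split; last first.
  by exists (expand x s), z => q; rewrite split /integ /pad /= -!catA.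
have [s' [c es]] : exists s' c, s = rcons s' c.
  by exists (padl (b :: p) ++ belast b p), (last b p); rewrite rcons_cat -lastI.
have [P eP] := expand_rcons x c s'.
exists P, (flip z) => q; rewrite split es eP -cats1 -catA /integ /pad /=.
by rewrite flipK /z es size_rcons /= flipK -!catA.
Qed.

(** * Words built from a root *)

Definition build (U r : seq letter) : seq letter := foldr integ r U.

(* The right frontier of [build U r] without its last letter, that of the root. *)
Fixpoint ends (U r : seq letter) : seq letter :=
  if U is _ :: U' then last One (build U r) :: ends U' r else [::].

Lemma build_neq0 U r : r != [::] -> build U r != [::].
Proof. by move=> r0; elim: U => //= x U; exact: integ_neq0. Qed.

Lemma build_rcons U c r : build (rcons U c) r = build U (integ c r).
Proof. by rewrite /build foldr_rcons. Qed.

Lemma ends_rcons U c r :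
  ends (rcons U c) r = rcons (ends U (integ c r)) (last One (integ c r)).
Proof. by elim: U => //= x U ->; rewrite build_rcons. Qed.

(** A reversed integral is an integral of the reversed word, and its first letter is the last letter
    of the original. *)
Lemma rev_build U r : r != [::] -> rev (build U r) = build (ends U r) (rev r).
Proof.
move=> r0; elim: U => //= x U IH.
have [y e] := rev_integ x (build U r).
have b0 : rev (build U r) != [::] by rewrite -size_eq0 size_rev size_eq0 build_neq0.
have [w ew] := integ_cons y b0.
by rewrite e IH -[integ x _]revK e ew rev_cons last_rcons.
Qed.

Lemma endsK U r : r != [::] -> ends (ends U r) (rev r) = U.
Proof.
move=> r0; elim: U => // x U IH.
rewrite -[LHS]/(last One (build (ends (x :: U) r) (rev r)) :: ends (ends U r) (rev r)).
rewrite IH -rev_build //=.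
by have [w ->] := integ_cons x (build_neq0 U r0); rewrite rev_cons last_rcons.
Qed.

Lemma build_prefix U m q : m != [::] -> exists Q, build U (m ++ q) = build U m ++ Q.
Proof.
move=> m0; elim: U => [|x U [Q /= ->]]; first by exists q.
exact: integ_prefix (build_neq0 _ m0).
Qed.

Lemma build_suffix U p m : m != [::] ->
  exists P U', forall q, build U (p ++ m ++ q) = P ++ build U' (m ++ q)
    /\ ends U (p ++ m ++ q) = ends U' (m ++ q).
Proof.
move=> m0; elim: U => [|x U [P [U' IH]]]; first by exists p, [::].
have [P' [y eP]] := integ_suffix x P (build_neq0 U' m0).
exists P', (y :: U') => q; have [e1 e2] := IH q.
(* Splitting off what depends on [q] lets [integ_suffix] apply with the fixed middle word
   [build U' m]. *)
have [Q eQ] := build_prefix U' q m0.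
have e : integ x (build U (p ++ m ++ q)) = P' ++ integ y (build U' (m ++ q)).
  by rewrite e1 eQ eP.
split=> //=; rewrite e2 e last_cat; congr (_ :: _).
have mq0 : m ++ q != [::] by case: (m) m0.
by have [w ->] := integ_cons y (build_neq0 U' mq0).
Qed.

(** [build_suffix] gives one [U'] for all [q]: the ends over [p ++ m] are those of [U'] over [m], so
    reversal over [m] recovers [U'], which is then used over [m ++ q]. *)
Lemma ends_glue U p m q : m != [::] ->
  ends U (p ++ m ++ q) = ends (ends (ends U (p ++ m)) (rev m)) (m ++ q).
Proof.
move=> m0; have [P [U' H]] := build_suffix U p m0.
have [_] := H [::]; rewrite !cats0 => ->; rewrite endsK //.
by have [] := H q.
Qed.

(** A final 1 is padded to 11 and expands to two distinct letters, a final 2 to two equal ones, so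
    only the last letter differs. As [p] is nonempty, the left padding does not see the change. *)
Lemma build_flip U p a : p != [::] ->
  exists P b, [/\ P != [::], build U (rcons p a) = rcons P b
                & build U (rcons p (flip a)) = rcons P (flip b)].
Proof.
move=> p0; elim: U => [|x U [P [b [P0 /= -> ->]]]]; first by exists p, a.
have eI c : integ x (rcons P c) = expand x (padl P ++ P) ++
    expand (iter (size (padl P ++ P)) flip x) (c :: padr [:: c]).
  rewrite -expand_cat /integ /pad /padr last_rcons -cats1 -!catA /=.
  by case: (P) P0.
set y := iter _ _ _ in eI; set E := expand _ _ in eI.
exists (rcons E y); rewrite !eI -cats1; case: b {eI}.
  by exists (flip y); rewrite -!cats1 -!catA /= flipK; split=> //; case: (E).
by exists y; rewrite -!cats1 -!catA /=; split=> //; case: (E).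
Qed.

Lemma ends_flip U p a : p != [::] ->
  ends U (rcons p a) = complement (ends U (rcons p (flip a))).
Proof.
move=> p0; elim: U => //= x U ->; congr (_ :: _).
have [P [b [_ /= -> ->]]] := build_flip (x :: U) a p0.
by rewrite !last_rcons flipK.
Qed.

(** * Shortest primitives *)

(** The second clause is the induction invariant: an open run of [flip x] is closed by the first
    letter [x] of the expansion. *)
Lemma runs_from_expand x s :
  (s != [::] -> Delta (expand x s) = map nat_of_letter s) /\
  forall n, runs_from (flip x) n (expand x s) = n :: map nat_of_letter s.
Proof.
elim: s x => [|a s IH] x; first by [].
have [_ H] := IH (flip x); rewrite flipK in H.
by split=> [_|n]; case: a => /=; rewrite ?eqxx ?[x == _]eq_sym ?eq_flip H.
Qed.

Lemma word_of_nats_map s : word_of_nats (map nat_of_letter s) = Some s.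
Proof. by elim: s => //= a s ->; case: a. Qed.

Lemma word_of_natsE t s : word_of_nats t = Some s -> t = map nat_of_letter s.
Proof.
elim: t s => [|n t IH] s /=; first by case=> <-.
case: n => [|[|[|n]]] //=; case: word_of_nats IH => //= u /(_ u erefl) -> [<-] //.
Qed.

Lemma D_expand x s : s != [::] -> D (expand x s) = Some (trim s).
Proof.
by move=> s0; have [H _] := runs_from_expand x s; rewrite /D H // word_of_nats_map.
Qed.

Lemma trim_pad v : v != [::] -> trim (pad v) = v.
Proof.
move=> v0; rewrite /trim.
have thl u : u != [::] -> forall t, trim_head (padl u ++ u ++ t) = u ++ t.
  by case: u => [|[] u].
rewrite {1}/pad thl // rev_cat.
rewrite rev_padr -padl_rev.
have r0 : rev v != [::] by rewrite -size_eq0 size_rev size_eq0.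
by have := thl _ r0 [::]; rewrite cats0 => ->; rewrite revK.
Qed.

Lemma pad_neq0 v : v != [::] -> pad v != [::].
Proof. by case: v => [|[] v]. Qed.

Lemma D_integ x v : v != [::] -> D (integ x v) = Some v.
Proof. by move=> v0; rewrite D_expand ?trim_pad ?pad_neq0. Qed.

Lemma runs_from_inv x n w s : runs_from x n w = map nat_of_letter s ->
  nseq n x ++ w = expand x s.
Proof.
elim: w x n s => [|y w IH] x n s /=.
  by case: s => [|a [|b s]] //= [->]; case: a.
case: eqP => [->|/eqP nyx] e.
  by rewrite -(IH _ _ _ e) -addn1 nseqD -catA.
case: s e => [|a s] //= [-> /IH /= ->].
have -> : y = flip x by case: (x) (y) nyx => [] [].
by case: a.
Qed.

Lemma primitive_expand w v : w != [::] -> D w = Some v ->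
  exists s, w = expand (head One w) s /\ trim s = v.
Proof.
case: w => // x w _; rewrite /D /=.
case E: word_of_nats => [s|] //= [<-]; exists s; split=> //.
exact: (runs_from_inv (word_of_natsE E)).
Qed.

Lemma trim_head_inv s : trim_head s != [::] ->
  let u := trim_head s in s = padl u ++ u \/ s = One :: u /\ padl u = [::].
Proof. by case: s => [|[] [|[] s]] //= _; auto. Qed.

(** Any other word trimmed to [v] has an additional 1 at an end where [pad] adds none. The sums are
    the lengths of the expansions, so strictness yields both minimality and uniqueness of the
    shortest primitive with given first letter. *)
Lemma trim_inv s v : v != [::] -> trim s = v ->
  s = pad v \/ sumn (map nat_of_letter (pad v)) < sumn (map nat_of_letter s).
Proof.
move=> v0 tv; set u := trim_head s.
have rv : trim_head (rev u) = rev v by rewrite -tv /trim revK.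
have r0 : trim_head (rev u) != [::] by rewrite rv -size_eq0 size_rev size_eq0.
have [r u_v] : exists r, u = v ++ r /\ (r = padr v \/ r = [:: One] /\ padr v = [::]).
  have := trim_head_inv r0; rewrite /= rv padl_rev => -[/(congr1 rev)|[/(congr1 rev)]].
    by rewrite revK rev_cat revK rev_padr => ->; exists (padr v); auto.
  by rewrite revK rev_cons revK -cats1 => ->; exists [:: One]; auto.
have plu : padl u = padl v by have [-> _] := u_v; case: (v) v0.
have u0 : u != [::] by have [-> _] := u_v; case: (v) v0.
have := trim_head_inv u0; rewrite /= -/u plu.
have [-> [->|[-> pr]]] := u_v => -[->|[-> pl]]; rewrite /pad ?pr ?pl; first by left.
- by right.
- by right; rewrite cats0 !map_cat !sumn_cat /= addn0 addn1 addnS.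
by right; rewrite cats0 /= map_cat sumn_cat /= addn1 add1n.
Qed.

Lemma shortest_integ x v : v != [::] -> shortest_primitive (integ x v) v.
Proof.
move=> v0; split=> [|w Dw]; first exact: D_integ.
have w0 : w != [::] by apply: contra_neq v0 => w0; move: Dw; rewrite w0 => -[].
have [s [-> /(trim_inv v0) H]] := primitive_expand w0 Dw.
by rewrite !size_expand; case: H => [-> //|]; exact: ltnW.
Qed.

Lemma shortest_primitiveE w v : v != [::] -> shortest_primitive w v ->
  w = integ (head One w) v.
Proof.
move=> v0 [Dw min].
have w0 : w != [::] by apply: contra_neq v0 => w0; move: Dw; rewrite w0 => -[].
have [s [ew /(trim_inv v0) [es|]]] := primitive_expand w0 Dw; first by rewrite /integ -es.
rewrite -(size_expand (head One w) s) -ew -(size_expand One) ltnNge.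
by rewrite [_ <= _]min //; exact: D_integ.
Qed.

(** * Minimal words *)

(** Two equal letters are excluded, since their derivative is 2 and not empty. *)
Definition root (r : seq letter) : Prop := exists c, r = [:: c] \/ r = [:: c; flip c].

Lemma root_neq0 r : root r -> r != [::].
Proof. by case=> c [] ->. Qed.

Lemma D_root r : root r -> D r = Some [::].
Proof. by case=> c [] ->; case: c. Qed.

Lemma rootP r : 0 < size r <= 2 -> D r = Some [::] -> root r.
Proof.
by case: r => [|[] [|[] [|]]] //= _; [exists One | exists One | exists Two | exists Two]; auto.
Qed.

Lemma root_eq r r' : root r -> root r' -> size r = size r' ->
  head One r = head One r' -> r = r'.
Proof. by case=> c [] -> [d [] ->] //= _ ->. Qed.

Lemma rev_root r : root r -> root (rev r).
Proof. by case=> c [] ->; [exists c | exists (flip c)]; rewrite ?flipK; auto. Qed.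

Lemma DiterS j w v : D w = Some v -> Diter j.+1 w = Diter j v.
Proof. by move=> e; rewrite /Diter iterSr /= e. Qed.

Lemma DwS j w v : D w = Some v -> Dw j.+1 w = Dw j v.
Proof. by move=> e; rewrite /Dw (DiterS _ e). Qed.

Lemma Diter_nil j : Diter j [::] = Some [::].
Proof. by elim: j => // j; rewrite /Diter iterS => ->. Qed.

Lemma Diter_build U r j : root r ->
  Diter j (build U r) = Some (if j <= size U then build (drop j U) r else [::]).
Proof.
move=> rr; have r0 := root_neq0 rr.
elim: U j => [|x U IH] [|j] //.
  by rewrite (DiterS _ (D_root rr)) Diter_nil.
by rewrite (DiterS _ (D_integ x (build_neq0 U r0))) IH.
Qed.

Lemma Dw_build U r j : root r ->
  Dw j (build U r) = if j <= size U then build (drop j U) r else [::].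
Proof. by move=> rr; rewrite /Dw Diter_build. Qed.

Lemma Cinf_build U r : root r -> Cinf (build U r).
Proof. by move=> rr j; rewrite Diter_build. Qed.

Lemma height_build U r : root r -> height (build U r) = (size U).+1.
Proof.
move=> rr; have Cw : Cinf (build U r) := Cinf_build (U := U) rr.
have [e lt] := heightP Cw.
case: (ltngtP (height (build U r)) (size U).+1) => // [h|/lt []]; last first.
  by rewrite Diter_build // ltnn.
move: e; rewrite Diter_build // -ltnS h => -[] /eqP.
by rewrite (negPf (build_neq0 _ (root_neq0 rr))).
Qed.

Lemma minimal_build U r : root r -> minimal (build U r).
Proof.
move=> rr; split; [exact: Cinf_build | by rewrite height_build |].
rewrite height_build // => j; rewrite ltnS => lt.
rewrite !Dw_build // lt (ltnW lt) (drop_nth One lt).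
exact: shortest_integ (build_neq0 _ (root_neq0 rr)).
Qed.

Lemma Droot_build U r : root r -> Droot (build U r) = r.
Proof. by move=> rr; rewrite /Droot height_build //= Dw_build // leqnn drop_size. Qed.

Lemma head_build_drop U r i : r != [::] -> i <= size U ->
  nth One (build (drop i U) r) 0 = nth One (rcons U (head One r)) i.
Proof.
move=> r0 le; rewrite nth_rcons; case: ltnP => [lt|ge].
  rewrite (drop_nth One lt) /=.
  by have [w ->] := integ_cons (nth One U i) (build_neq0 (drop i.+1 U) r0).
have -> : i = size U by apply/eqP; rewrite eqn_leq le.
by rewrite drop_size eqxx nth0.
Qed.

(** The value 0 never occurs: a word starting with 2 gets no left padding, so its shortest integral
    starts with two equal letters. *)
Lemma left_frontier_build U r : root r ->
  left_frontier (build U r) = map nat_of_letter (rcons U (head One r)).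
Proof.
move=> rr; have r0 := root_neq0 rr; rewrite /left_frontier /Psi height_build //.
apply: (@eq_from_nth _ 0); first by rewrite size_mkseq size_map size_rcons.
move=> i; rewrite size_mkseq => lt; have le : i <= size U by [].
rewrite nth_mkseq // (nth_map One) ?size_rcons // /Psi_letter.
rewrite !Dw_build // le (leq_trans (leq_pred i) le) -head_build_drop //.
case: i lt le => //= i lt le; rewrite (drop_nth One le) /=.
by case: (build _ r) (build_neq0 (drop i.+1 U) r0) => [|[] v] //=; rewrite eqxx.
Qed.

Lemma right_frontier_build U r : root r ->
  right_frontier (build U r) = map nat_of_letter (rcons (ends U r) (last One r)).
Proof.
move=> rr; rewrite /right_frontier rev_build ?root_neq0 //.
rewrite -/(left_frontier _) left_frontier_build; last exact: rev_root.
by congr (map _ (rcons _ _)); case: rr => c [] ->.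
Qed.

Lemma build_unique U w r : r != [::] -> Dw (size U) w = r ->
  (forall j, j < size U -> shortest_primitive (Dw j w) (Dw j.+1 w)
     /\ head One (Dw j w) = nth One U j) ->
  w = build U r.
Proof.
move=> r0; elim: U w => [|x U IH] w; first by [].
move=> /= er H; have [[Dw1 min] /= hx] := H 0 isT.
have e1 : Dw 1 w = build U r.
  apply: IH => [|j lt]; first by rewrite -(DwS _ Dw1).
  by rewrite -!(DwS _ Dw1); exact: (H j.+1 lt).
have v0 : build U r != [::] := build_neq0 U r0.
by rewrite -e1 -hx -shortest_primitiveE // e1.
Qed.

Lemma minimal_unique w U c : minimal w -> 0 < size (Droot w) <= 2 ->
  left_frontier w = map nat_of_letter (rcons U c) ->
  [/\ root (Droot w), head One (Droot w) = c & w = build U (Droot w)].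
Proof.
move=> [Cw hw min] szr lf.
have hE : height w = (size U).+1.
  by have := congr1 size lf; rewrite size_mkseq size_map size_rcons.
have hd j : j <= size U -> head One (Dw j w) = nth One (rcons U c) j.
  move=> le; have := congr1 (fun s => nth 0 s j) lf.
  rewrite nth_mkseq ?hE // (nth_map One) ?size_rcons // /Psi_letter.
  (* The value 0 is excluded because the frontier is the code of a word over Sigma. *)
  by case: ifP => [_|_ /nat_of_letter_inj <-]; [case: nth | rewrite nth0].
have er : Droot w = Dw (size U) w by rewrite /Droot hE.
have rr : root (Droot w).
  apply: rootP szr _; have [] := heightP Cw; rewrite hE /Diter iterS -/(Diter _ _).
  by rewrite er /Dw; case: (Diter (size U) w).
split=> //; first by rewrite er hd // nth_rcons ltnn eqxx.
apply: build_unique (root_neq0 rr) (esym er) _ => j lt; split.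
  by apply: min; rewrite hE.
by rewrite hd 1?ltnW // nth_rcons lt.
Qed.

(** Measuring the root by [size r] treats single and double roots at once. The word behind the value
    chosen by [epsilon] must be [build U r], by [minimal_unique] and [root_eq]. *)
Lemma GammaE U r : root r ->
  Gamma (fun w => size (Droot w) = size r) (rcons U (head One r)) =
  rcons (ends U r) (last One r).
Proof.
move=> rr; set rooted := fun w => _; set V := rcons (ends U r) _.
have exV : frontier_image rooted (rcons U (head One r)) V.
  exists (build U r); split; [exact: minimal_build | by rewrite /rooted Droot_build | |].
    exact: left_frontier_build.
  exact: right_frontier_build.
have -> : Gamma rooted (rcons U (head One r)) =
    ClassicalEpsilon.epsilon (inhabits [::]) (frontier_image rooted (rcons U (head One r))).
  by case: U {V exV}.
have [w [mw szw lf rf]] := ClassicalEpsilon.epsilon_spec (inhabits [::]) _ (ex_intro _ _ exV).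
have szr : 0 < size (Droot w) <= 2 by rewrite szw; case: rr => c [] ->.
have [rw hw ew] := minimal_unique mw szr lf.
have er := root_eq rw rr szw hw.
by apply: (inj_map nat_of_letter_inj); rewrite -rf ew er right_frontier_build.
Qed.

Lemma Gamma_sE U c : Gamma_s (rcons U c) = rcons (ends U [:: c]) c.
Proof. by apply: (@GammaE U [:: c]); exists c; left. Qed.

Lemma Gamma_dE U c : Gamma_d (rcons U c) = rcons (ends U [:: c; flip c]) (flip c).
Proof. by apply: (@GammaE U [:: c; flip c]); exists c; right. Qed.

(** * Relations between the frontier maps *)

Lemma Gamma_sK : involutive Gamma_s.
Proof.
by case/lastP=> [|U c] //; rewrite !Gamma_sE (endsK U (r := [:: c])).
Qed.

Lemma Pi_rcons U X : Pi (rcons U X) = Gamma_s (rcons (Gamma_s U) (flip X)).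
Proof.
case/lastP: U => [|U a].
  by rewrite /Pi (Gamma_sE [::]) (Gamma_dE [::]) (Gamma_sE [::] (flip X)).
rewrite /Pi !Gamma_sE Gamma_dE !ends_rcons; case: X.
  (* The double root 12 integrates to [a], [flip a], [a], [a]. Its first three letters are the
     integral of 1, a palindrome undone by [endsK]; its last two are the integral of 2. *)
  have := ends_glue (ends U [:: a; flip a; a]) [:: a; flip a] [:: a] (isT : [:: a] != [::]).
  by rewrite (endsK U (r := [:: a; flip a; a])) // /integ /rev /= ?flipK => <-.
(* Here 21 integrates to [a], [a], [flip a], [a]: the first two letters are the integral of 2, the
   last three that of 1. *)
have := ends_glue (ends U [:: a; a]) [:: a] [:: flip a; a] (isT : [:: a] != [::]).
by rewrite (endsK U (r := [:: a; a])) // /integ /rev /= ?flipK => <-.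
Qed.

Lemma Gamma_s_rcons_One U :
  Gamma_s (rcons U One) = rcons (Gamma_d (Gamma_s (Gamma_d U))) One.
Proof.
case/lastP: U => [|U a]; first by rewrite (Gamma_sE [::]).
rewrite Gamma_dE !Gamma_sE Gamma_dE ends_rcons flipK.
(* The integral [a], [flip a], [a] of 1 is covered by two double roots that overlap in [flip a]. *)
have := ends_glue U [:: a] [:: a] (isT : [:: flip a] != [::]).
by rewrite /integ /rev /= ?flipK => <-.
Qed.

Lemma Gamma_s_rcons_Two V :
  Gamma_s (rcons V Two) = rcons (complement (Gamma_d V)) Two.
Proof.
case/lastP: V => [|V c]; first by rewrite (Gamma_sE [::]).
rewrite Gamma_dE Gamma_sE ends_rcons /complement map_rcons flipK.
(* The integral [c], [c] of 2 differs from the double root [c], [flip c] only in its last letter. *)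
have := ends_flip V c (isT : [:: c] != [::]); rewrite /complement /= => <-.
by rewrite /integ.
Qed.

Theorem theorem4 (U : seq letter) :
  [/\ Pi (rcons U One) = rcons (complement (Pi U)) Two,
      Pi (rcons U Two) = rcons (Pi (Pi U)) One,
      forall X : letter, Gamma_s (rcons U X) = Pi (rcons (Gamma_s U) (flip X)) &
      Gamma_d U = Pi (Gamma_s U)].
Proof.
split.
- by rewrite Pi_rcons Gamma_s_rcons_Two.
- by rewrite Pi_rcons Gamma_s_rcons_One.
- by move=> X; rewrite Pi_rcons Gamma_sK flipK.
by rewrite /Pi Gamma_sK.
Qed.
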